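(* Every connected $3$-regular graph $G$ other than $K_{3,3}$ and $K_4$ satisfies $m(G)=3$.
   Context: Graphs are finite, simple, with at least one vertex. A $k$-list assignment $L$ of a graph $G$ assigns to each vertex $v$ a set $L(v)$ of exactly $k$ colors. A proper $L$-list coloring is a map $c$ on $V(G)$ with $c(v)\in L(v)$ for all $v$ and $c(u)\ne c(v)$ for every edge $uv$. $G$ is uniquely $k$-list colorable (U$k$LC) if there exists a $k$-list assignment $L$ for which $G$ has exactly one proper $L$-list coloring. $G$ has property $M(k)$ if it is not uniquely $k$-list colorable. The $m$-number $m(G)$ is the least positive integer $k$ such that $G$ has property $M(k)$; equivalently, $m(G)-1$ is the largest integer $k$ such that $G$ is U$k$LC. *)

(* Defs.v *)
From mathcomp Require Import all_boot.

Set Implicit Arguments.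
Unset Strict Implicit.
Unset Printing Implicit Defensive.

(* Finite simple graphs. The empty vertex type is not excluded by the record;
   statements about graphs with at least one vertex assume 0 < #|G|. *)
Record sgraph := SGraph {
  vertex :> finType;
  edge : rel vertex;
  edge_sym : symmetric edge;
  edge_irr : irreflexive edge
}.

Definition regular (d : nat) (G : sgraph) : Prop :=
  forall v : G, #|[set w : G | edge v w]| = d.

Definition connected (G : sgraph) : Prop :=
  forall v w : G, connect (@edge G) v w.

Definition isomorphic (G H : sgraph) : Prop :=
  exists2 f : G -> H, bijective f & forall v w : G, edge (f v) (f w) = edge v w.

Definition complete_edge (n : nat) : rel 'I_n := fun i j => i != j.

Lemma complete_edge_sym n : symmetric (@complete_edge n).
Proof. by move=> i j; rewrite /complete_edge eq_sym. Qed.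

Lemma complete_edge_irr n : irreflexive (@complete_edge n).
Proof. by move=> i; rewrite /complete_edge eqxx. Qed.

Definition complete_graph (n : nat) : sgraph :=
  SGraph (@complete_edge_sym n) (@complete_edge_irr n).

Definition complete_bipartite_edge (m n : nat) : rel ('I_m + 'I_n)%type :=
  fun x y => match x, y with
             | inl _, inr _ | inr _, inl _ => true
             | _, _ => false
             end.

Lemma complete_bipartite_edge_sym m n : symmetric (@complete_bipartite_edge m n).
Proof. by case=> i [] j. Qed.

Lemma complete_bipartite_edge_irr m n : irreflexive (@complete_bipartite_edge m n).
Proof. by case. Qed.

Definition complete_bipartite_graph (m n : nat) : sgraph :=
  SGraph (@complete_bipartite_edge_sym m n) (@complete_bipartite_edge_irr m n).

Definition list_assignment (k : nat) (G : sgraph) (C : finType)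
    (L : G -> {set C}) : Prop :=
  forall v : G, #|L v| = k.

Definition list_coloring (G : sgraph) (C : finType) (L : G -> {set C})
    (c : {ffun G -> C}) : Prop :=
  (forall v : G, c v \in L v) /\ (forall v w : G, edge v w -> c v != c w).

(* The palette C is existentially quantified over finite types: this is no
   restriction, since finitely many finite lists use finitely many colors. *)
Definition uniquely_list_colorable (k : nat) (G : sgraph) : Prop :=
  exists (C : finType) (L : G -> {set C}),
    list_assignment k L /\ exists! c : {ffun G -> C}, list_coloring L c.

Definition property_M (k : nat) (G : sgraph) : Prop :=
  ~ uniquely_list_colorable k G.

(* m(G) = k, where m(G) is the least positive integer with property M. *)
Definition m_number_is (G : sgraph) (k : nat) : Prop :=
  [/\ 0 < k, property_M k G & forall j, 0 < j -> property_M j G -> k <= j].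

Lemma m_number_unique (G : sgraph) (k l : nat) :
  m_number_is G k -> m_number_is G l -> k = l.
Proof.
move=> [k0 Mk mink] [l0 Ml minl]; apply/eqP.
by rewrite eqn_leq mink // minl.
Qed.

(* Main.v *)
(** [m(G) <= 3]: evaluate the edge polynomial [prod (x_u - x_v)], weighted at each
vertex so that the sums over its 3-element list of the powers [x^0] and [x^1]
vanish.  If [|E| < 2|V|], every monomial has degree at most 1 at some vertex, so
the weighted sum over all choices from the lists is 0; but a unique colouring
would contribute its only nonzero term.  A cubic graph has [|E| = 3|V|/2].

[m(G) > 2]: take a cycle with a chord [vw] such that the successors [v+], [w+]
on the cycle are not adjacent.  Colour the vertices by themselves, except that
[v+] and [w+] share a colour, and let the list of a vertex be its own colour and
that of its successor (off the cycle, of a neighbour nearer to the cycle).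
Changing the colour at one vertex forces the change at its successor, hence
around the whole cycle, and then [v] and [w] clash.  The end of a maximal path
has all its neighbours on the path, which yields a cycle with a chord.  If
all chorded cycles fail, chords rotate along the cycle, so G is a Moebius ladder,
which is K_4, K_{3,3}, or contains a good 6-cycle. *)

Require Import Defs.
From mathcomp Require Import all_boot all_algebra.
From mathcomp Require Import ring zify.

Set Implicit Arguments.
Unset Strict Implicit.
Unset Printing Implicit Defensive.

Import GRing.Theory.

(** * Unique colourings from lists of size two *)

(** A colouring that deviates at one vertex deviates at all its iterates under [p], hence at [v] and
    at [w], and both then get the colour [p v]. *)
Lemma unique2_of_parent (G : sgraph) (p : G -> G) (v w : G) :
    (forall x, edge x (p x)) -> edge v w -> ~~ edge (p v) (p w) ->
    (forall x, fconnect p x v) -> (forall x, fconnect p x w) ->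
  uniquely_list_colorable 2 G.
Proof.
move=> xp vw npp xv xw.
pose c x := if x == p w then p v else x.
have c_proper x y : edge x y -> c x != c y.
  rewrite /c; case: (x =P p w) => [->|_]; case: (y =P p w) => [->|_].
  - by rewrite edge_irr.
  - by move=> wy; apply: contra npp => /eqP ->; rewrite edge_sym.
  - by move=> xw'; apply: contra npp => /eqP <-.
  - by move=> xy; apply: contraL xy => /eqP ->; rewrite edge_irr.
exists G, (fun x => [set c x; c (p x)]); split.
  by move=> x; rewrite cards2 c_proper.
exists [ffun x => c x]; split.
  by split=> [x|x y xy]; rewrite !ffunE ?set21 //; exact: c_proper.
move=> c' [c'L c'e]; apply/ffunP => x; rewrite ffunE.
apply/eqP/negPn/negP => nx.
have flip y : c y != c' y -> c' y = c (p y).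
  by have := c'L y; rewrite !inE => /orP[/eqP->|/eqP//]; rewrite eqxx.
have step y : c y != c' y -> c (p y) != c' (p y).
  by move=> ny; rewrite -(flip _ ny); exact: c'e.
have reach y : fconnect p x y -> c y != c' y.
  by move/iter_findex <-; elim: (findex _ _ _) => //= n; exact: step.
have := c'e v w vw; rewrite (flip v (reach v (xv x))) (flip w (reach w (xw x))).
rewrite /c eqxx.
by case: ifP; rewrite eqxx.
Qed.

Lemma parent_of_connected (G : sgraph) (q : seq G) (x0 : G) :
    connected G -> x0 \in q ->
  exists p : G -> G, [/\ {in q, p =1 next q},
    forall x, x \notin q -> edge x (p x) & forall x, exists n, iter n p x \in q].
Proof.
move=> conG x0q.
pose P x n := [exists t : n.-tuple G, path (@edge G) x t && (last x t \in q)].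
have exP x : exists n, P x n.
  have /connectP[s es ls] := conG x x0.
  by exists (size s); apply/existsP; exists (in_tuple s); rewrite /= es -ls.
pose d x := ex_minn (exP x).
(* The default [x] is never taken: the first step of a shortest walk to [q] lowers the distance
   [d]. *)
pose p x := if x \in q then next q x
            else odflt x [pick y | edge x y && (d y < d x)].
have pP x : x \notin q -> edge x (p x) && (d (p x) < d x).
  move=> xq; rewrite /p (negPf xq); case: pickP => //= nex; exfalso.
  move: nex; rewrite {2}/d; case: ex_minnP => n /existsP[t] /andP[].
  case: t => [[|y t] /= szt]; first by rewrite (negPf xq).
  move=> /andP[xy yt] lt _ /(_ y) /negP; apply; rewrite xy /=.
  rewrite /d; case: ex_minnP => m _ minm; rewrite -(eqP szt) ltnS.
  by apply: minm; apply/existsP; exists (in_tuple t); rewrite /= yt.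
exists p; split=> [x xq|x /pP/andP[] //|x]; first by rewrite /p xq.
have [n] := ubnP (d x); elim: n x => // n IHn x dx.
have [xq|/pP /andP[_ lt]] := boolP (x \in q); first by exists 0.
have [|k Hk] := IHn (p x); first exact: leq_trans lt _.
by exists k.+1; rewrite iterSr.
Qed.

Lemma unique2_of_cycle (G : sgraph) (q : seq G) (v w : G) :
    connected G -> uniq q -> cycle (@edge G) q -> v \in q -> w \in q ->
    edge v w -> ~~ edge (next q v) (next q w) ->
  uniquely_list_colorable 2 G.
Proof.
move=> conG Uq cq vq wq vw nvw.
have [p [pq pnq reach]] := parent_of_connected conG vq.
have reach_q x y : y \in q -> fconnect p x y.
  move=> yq; have [n nq] := reach x.
  apply: connect_trans (fconnect_iter p n x) _.
  rewrite (fconnect_cycle (p := q)) //.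
  by apply: cycle_from_next => // z zq; rewrite /= pq.
apply: (@unique2_of_parent G p v w); rewrite ?pq // => x; try exact: reach_q.
have [xq|/pnq //] := boolP (x \in q).
by rewrite pq //; exact: next_cycle.
Qed.

(** * Existence of a chorded cycle *)

Lemma maximal_path (G : sgraph) (x0 : G) :
  exists x s, [/\ uniq (x :: s), path (@edge G) x s &
    forall y, edge x y -> y \in s].
Proof.
suff ext n (x : G) s : uniq (x :: s) -> path (@edge G) x s ->
    #|G| < n + size (x :: s) ->
    exists x s, [/\ uniq (x :: s), path (@edge G) x s &
    forall y, edge x y -> y \in s].
  by apply: (ext #|G| x0 [::]) => //; rewrite addn1.
elim: n x s => [|n IHn] x s Us ps lt.
  by have /card_uniqP eqs := Us; move: lt; rewrite add0n -eqs ltnNge max_card.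
have [/existsP[y /andP[xy ys]]|/existsPn nex] :=
  boolP [exists y, edge x y && (y \notin s)].
  apply: (IHn y (x :: s)); last by rewrite /= addnS -addSn.
    rewrite cons_uniq Us inE negb_or ys !andbT.
    by apply: contraL xy => /eqP ->; rewrite edge_irr.
  by rewrite /= ps edge_sym xy.
by exists x, s; split=> // y xy; have := nex y; rewrite xy negbK.
Qed.

(** The neighbour [b] of [x] farthest along a maximal path closes the cycle, so all neighbours of
    [x] lie on it. The bounds on [i] exclude the two cycle neighbours of [x]. *)
Lemma chorded_cycle (G : sgraph) (x0 : G) :
    (forall v : G, 2 < #|[set w | edge v w]|) ->
  exists x s i, [/\ uniq (x :: s), cycle (@edge G) (x :: s),
    1 < i < size s & edge x (nth x (x :: s) i)].
Proof.
move=> deg3.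
have [x [s [Us ps Ns]]] := maximal_path x0.
have [y xy] : exists y, edge x y.
  have /card_gt0P[y] : 0 < #|[set w | edge x w]| by apply: leq_trans (deg3 x).
  by rewrite inE => xy; exists y.
have [b xb maxb] := arg_maxnP (fun z => index z s) xy.
have bs := Ns b xb.
case/splitPr: s / bs Us ps Ns maxb => s1 s2 Us ps Ns maxb.
have {}Ns z : edge x z -> z \in rcons s1 b.
  move=> xz; have := maxb z xz; have := Ns z xz.
  move: Us; rewrite cons_uniq cat_uniq /= => /and5P[_ _ /norP[nb _] _ _].
  rewrite !index_cat (negPf nb) /= eqxx addn0 mem_cat mem_rcons !inE.
  have [zs1|] //= := boolP (z \in s1); first by rewrite orbT.
  by case: (z =P b) => //= /eqP; rewrite eq_sym => /negPf ->; rewrite addnS ltnNge leq_addr.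
exists x, (rcons s1 b).
have Us' : uniq (x :: rcons s1 b).
  by move: Us; rewrite -cat_rcons -cat_cons cat_uniq => /andP[].
have ps' : path (@edge G) x (rcons s1 b).
  by move: ps; rewrite -cat_rcons cat_path => /andP[].
(* The excluded vertices are the two neighbours of [x] along the cycle; degree at least 3 leaves
   another one. *)
have [a xa] : exists2 a, edge x a & a \notin [set head x (rcons s1 b); b].
  apply/exists_inP; rewrite -[X in is_true X]negbK; apply/exists_inPn => sub.
  have /subset_leq_card : [set w | edge x w] \subset [set head x (rcons s1 b); b].
    by apply/subsetP => z; rewrite inE => xz; have := sub z xz; rewrite negbK.
  by rewrite leqNgt cards2 (leq_ltn_trans _ (deg3 x)) //; case: (_ != _).
rewrite !inE negb_or => /andP[ah ab].
have as1 := Ns a xa.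
exists (index a (rcons s1 b)).+1; split=> //.
- by rewrite /= rcons_path ps' last_rcons edge_sym.
- have : index a (rcons s1 b) < size (rcons s1 b) by rewrite index_mem.
  rewrite size_rcons ltnS leq_eqVlt => /orP[/eqP ei|lt].
    by case/eqP: ab; rewrite -(nth_index x as1) ei nth_rcons ltnn eqxx.
  rewrite !ltnS lt andbT lt0n; apply: contra ah => /eqP i0.
  by rewrite -[a in a == _](nth_index x as1) i0 nth0.
- by rewrite /= nth_index.
Qed.

Lemma next_nth_mod (T : eqType) (x0 : T) (q : seq T) m :
    uniq q -> 0 < size q ->
  next q (nth x0 q (m %% size q)) = nth x0 q (m.+1 %% size q).
Proof.
case: q => // y s Us _; set n := size (y :: s).
have lt : m %% n < n by rewrite ltn_mod.
rewrite next_nth mem_nth // index_uniq // -[m.+1]addn1 -modnDml addn1.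
move: lt; rewrite leq_eqVlt => /orP[/eqP e|lt].
  by rewrite e modnn nth_default //; case: e => ->.
by rewrite (modn_small lt) /=; apply: set_nth_default.
Qed.

Lemma isomorphic_of_injection (G H : sgraph) (f : H -> G) :
    injective f -> #|G| <= #|H| ->
    (forall v w, edge (f v) (f w) = edge v w) ->
  isomorphic G H.
Proof.
move=> fI cGH fe; have [g fK gK] := inj_card_bij fI cGH.
by exists g => [|v w]; [exists f | rewrite -fe !gK].
Qed.

(** * Rotating chords and Moebius ladders *)

Lemma K4_or_K33_of_rotating_chords (G : sgraph) x s i :
    connected G -> regular 3 G ->
    (forall (q : seq G) v w, uniq q -> cycle (@edge G) q ->
       v \in q -> w \in q -> edge v w -> edge (next q v) (next q w)) ->
    uniq (x :: s) -> cycle (@edge G) (x :: s) -> 1 < i < size s ->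
    edge x (nth x (x :: s) i) ->
  isomorphic G (complete_graph 4) \/ isomorphic G (complete_bipartite_graph 3 3).
Proof.
move=> conG cubG rot Uq cq /andP[i1 i_s] xi.
set q := x :: s in Uq cq xi.
pose n := size q; have szn : n = (size s).+1 by [].
(* Positions on the cycle are read modulo [n], so adding [n.-1] is a step back. *)
pose u m := nth x q (m %% n).
have uP m : u m \in q by rewrite mem_nth // ltn_mod.
have u_next m : next q (u m) = u m.+1 by exact: next_nth_mod.
have u_eq a b : (u a == u b) = (a == b %[mod n]) by rewrite nth_uniq // ltn_mod.
have u_eqm m a b : a < n -> b < n -> (u (m + a) == u (m + b)) = (a == b).
  by move=> an bn; rewrite u_eq eqn_modDl !modn_small.
have adj1 m : edge (u m) (u m.+1) by rewrite -u_next; exact: next_cycle.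
have adji m : edge (u m) (u (m + i)).
  elim: m => [|m IHm]; first by rewrite add0n /u mod0n modn_small //; lia.
  by rewrite addSn -!u_next; exact: rot.
have adjp m : edge (u m) (u (m + n.-1)).
  rewrite edge_sym; have := adj1 (m + n.-1).
  by rewrite -addnS prednK // {2}/u modnDr.
have nbr m y : edge (u m) y = (y \in [set u (m + 1); u (m + n.-1); u (m + i)]).
  suff -> : [set u (m + 1); u (m + n.-1); u (m + i)] = [set w | edge (u m) w].
    by rewrite inE.
  apply/eqP; rewrite eqEcard cubG; apply/andP; split.
    apply/subsetP => z; rewrite !inE => /orP[/orP[]|] /eqP -> //.
    by rewrite addn1.
  rewrite -setUA cardsU1 cards2 !inE !u_eqm; lia.
have edgeE a b : edge (u a) (u b) =
    [|| b == a + 1 %[mod n], b == a + n.-1 %[mod n] | b == a + i %[mod n]].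
  by rewrite nbr !inE !u_eq orbA.
(* The chord from [u (n - i)] ends at [u 0], so [n - i] is 1, [n.-1] or [i]; the bounds on [i] leave
   only the last. *)
have n2i : n = i.*2.
  have := adji (n - i); rewrite subnK; last by lia.
  rewrite edge_sym {1}/u modnn -[0](mod0n n) -/(u 0) edgeE !add0n !modn_small; lia.
(* Neighbours of cycle vertices stay on the cycle, so by connectedness it spans [G]. *)
have q_all y : y \in q.
  have /connectP[p] := conG x y.
  have: x \in q by exact: mem_head.
  elim: p (x) => [|z p IHp] w wq /= => [_ -> //|/andP[wz zp]].
  apply: IHp => //; move: wz.
  rewrite -(nth_index x wq) -[index w q](@modn_small _ n) ?index_mem //.
  by rewrite -/(u _) nbr !inE => /orP[/orP[]|] /eqP ->; exact: uP.
have cG : #|G| = n.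
  by rewrite /n -(card_uniqP Uq); apply: eq_card => y; rewrite q_all.
have [i2|i3|i4] : [\/ i = 2, i = 3 | 3 < i].
  case: (ltngtP i 3) => [lt|lt|->].
  - by apply: Or31; lia.
  - exact: Or33.
  - exact: Or32.
- left; have n4 : n = 4 by rewrite n2i i2.
  apply: (@isomorphic_of_injection _ (complete_graph 4) (fun j : 'I_4 => u j)).
  + move=> j k /eqP; rewrite u_eq n4 !modn_small // => /eqP; exact: val_inj.
  + by rewrite cG card_ord n4.
  + move=> j k; rewrite edgeE n4 i2 /= /complete_edge.
    by case: j k => [[|[|[|[|?]]]] ?] [[|[|[|[|?]]]] ?].
- right; have n6 : n = 6 by rewrite n2i i3.
  (* The parity of the position gives the bipartition. *)
  pose code (z : 'I_3 + 'I_3) : nat :=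
    match z with inl j => j.*2 | inr j => j.*2.+1 end.
  apply: (@isomorphic_of_injection _ (complete_bipartite_graph 3 3)
            (fun z => u (code z))).
  + move=> y z /eqP; rewrite u_eq n6 /code.
    by case: y z => [[[|[|[|?]]] ?]|[[|[|[|?]]] ?]] [[[|[|[|?]]] ?]|[[|[|[|?]]] ?]] //= _;
      congr (_ _); apply: val_inj.
  + by rewrite cG card_sum !card_ord n6.
  + move=> y z; rewrite edgeE n6 i3 /code /=.
    by case: y z => [[[|[|[|?]]] ?]|[[|[|[|?]]] ?]] [[[|[|[|?]]] ?]|[[|[|[|?]]] ?]].
exfalso.
(* The 6-cycle 0, 1, 2, i+2, i+1, i has the chord {1, i+1}, whose successors
   2 and i are not adjacent. *)
have sm a b : a < n -> b < n -> (u a == u b) = (a == b).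
  by move=> an bn; rewrite u_eq !modn_small.
pose q6 := [:: u 0; u 1; u 2; u (i + 2); u (i + 1); u i].
have Uq6 : uniq q6 by rewrite /= !inE !sm; lia.
have cq6 : cycle (@edge G) q6.
  have e2 : edge (u 2) (u (i + 2)) by rewrite addnC.
  have e21 : edge (u (i + 2)) (u (i + 1)) by rewrite edge_sym addn2 addn1.
  have e10 : edge (u (i + 1)) (u i) by rewrite edge_sym addn1.
  have e0 : edge (u i) (u 0) by rewrite edge_sym; exact: (adji 0).
  by rewrite /= !adj1 e2 e21 e10 e0.
have := rot q6 (u 1) (u (i + 1)) Uq6 cq6; rewrite !inE !eqxx !orbT addnC adji.
move=> /(_ isT isT isT).
rewrite addnC (next_nth_mod (u 0) 1 Uq6) // (next_nth_mod (u 0) 4 Uq6) //=.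
(* The neighbours of [u 2] are [u 3], [u 1] and [u (i + 2)]; none is [u i] when [3 < i]. *)
rewrite nbr !inE.
have -> : u (2 + n.-1) = u 1.
  by apply/eqP; rewrite u_eq (_ : 2 + n.-1 = 1 + n) ?modnDr //; lia.
rewrite !sm; lia.
Qed.

(** * The polynomial argument for lists of size three *)

(** Two linear equations in three unknowns are solved by the cyclic differences of the values of
    [X], which are nonzero by injectivity. *)
Lemma moment_weights (C : finType) (X : C -> int) (A : {set C}) :
    injective X -> #|A| = 3 ->
  exists w : C -> int, (forall z, (w z != 0)%R = (z \in A)) /\
    forall m, m < 2 -> (\sum_z w z * X z ^+ m = 0)%R.
Proof.
move=> XI; rewrite cardE; have := enum_uniq A.
case eA: (enum A) => [|a [|b [|c []]]] //= U _.
have [ab ac bc] : [/\ a != b, a != c & b != c].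
  by move: U; rewrite !inE negb_or => /and3P[/andP[-> ->] ->].
pose w z : int := (if z == a then X b - X c else if z == b then X c - X a
  else if z == c then X a - X b else 0)%R.
have [wa wb wc] : [/\ w a = X b - X c, w b = X c - X a & w c = X a - X b]%R.
  by rewrite /w !eqxx ![_ == a]eq_sym ![c == b]eq_sym (negPf ab) (negPf ac) (negPf bc).
have neX y z : y != z -> (X y - X z != 0)%R by rewrite subr_eq0 (inj_eq XI).
have wA z : (w z != 0)%R = (z \in A).
  rewrite -mem_enum eA !inE.
  case: (z =P a) => [->|/eqP za]; first by rewrite wa neX.
  case: (z =P b) => [->|/eqP zb]; first by rewrite wb neX // eq_sym.
  case: (z =P c) => [->|/eqP zc]; first by rewrite wc neX.
  by rewrite /w (negPf za) (negPf zb) (negPf zc) eqxx.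
exists w; split=> // m m2.
rewrite (bigID (mem A)) /= [X in (_ + X)%R]big1 => [|z]; last first.
  by rewrite -wA negbK => /eqP ->; rewrite mul0r.
rewrite addr0 -big_enum eA !big_cons big_nil wa wb wc /=.
by case: m m2 => [|[]] // _; ring.
Qed.

(** The exponents [k] make the induction go through: expanding the factor of one edge raises one
    exponent by 1, at either end, and keeps the bound. *)
Lemma weighted_sum_eq0 (V C : finType) (X : C -> int) (w : V -> C -> int)
    (s : seq (V * V)) (k : V -> nat) :
    (forall v m, m < 2 -> (\sum_z w v z * X z ^+ m = 0)%R) ->
    size s + \sum_v k v < #|V|.*2 ->
  (\sum_(c : {ffun V -> C}) (\prod_v (w v (c v) * X (c v) ^+ k v)) *
     \prod_(e <- s) (X (c e.1) - X (c e.2)) = 0)%R.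
Proof.
move=> w0; elim: s k => [|e s IHs] k lt.
  under eq_bigr do rewrite big_nil mulr1.
  (* With no edge left the sum is a product over the vertices, and some vertex has exponent below
     2. *)
  rewrite -(bigA_distr_bigA (fun v z => w v z * X z ^+ k v)%R).
  have [/existsP[v kv]|/existsPn k2] := boolP [exists v, k v < 2].
    by rewrite (bigD1 v) //= w0 // mul0r.
  move: lt; rewrite add0n ltnNge -muln2 -sum_nat_const leq_sum // => v _.
  by rewrite leqNgt.
pose up u v := k v + (v == u).
have sum_up u : \sum_v up u v = (\sum_v k v).+1.
  rewrite big_split /= -addn1; congr (_ + _).
  by rewrite (bigD1 u) //= eqxx big1 // => v /negPf ->.
have prod_up u (c : {ffun V -> C}) :
  (\prod_v (w v (c v) * X (c v) ^+ up u v) =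
   \prod_v (w v (c v) * X (c v) ^+ k v) * X (c u))%R.
  under eq_bigr do rewrite exprD mulrA.
  rewrite big_split /=; congr (_ * _)%R.
  by rewrite (bigD1 u) //= eqxx expr1 big1 ?mulr1 // => v /negPf ->.
under eq_bigr do rewrite big_cons mulrA mulrBr -!prod_up mulrBl.
by rewrite sumrB !IHs ?subr0 // sum_up addnS -addSn.
Qed.

(** Handshake count: the ranking [r] picks one orientation of each edge, and swapping the ends gives
    the other. *)
Lemma edge_count (G : sgraph) (r : G -> nat) : injective r ->
  \sum_(v : G) #|[set w | edge v w]| =
  #|[set e : G * G | edge e.1 e.2 && (r e.1 < r e.2)]|.*2.
Proof.
move=> rI; rewrite -addnn.
under eq_bigr do rewrite -sum1dep_card.
rewrite pair_big_dep /= (bigID (fun e : G * G => r e.1 < r e.2)) /=.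
congr (_ + _); first by rewrite sum1dep_card.
pose swap (e : G * G) := (e.2, e.1).
have swapK : involutive swap by case.
rewrite (reindex_inj (inv_inj swapK)) -sum1dep_card; apply: eq_bigl => -[v w] /=.
rewrite edge_sym; case vw: (edge v w) => //=.
have: r v != r w by apply: contraTneq vw => /rI ->; rewrite edge_irr.
by case: ltngtP.
Qed.

Lemma edge_bound_of_unique3 (G : sgraph) :
    uniquely_list_colorable 3 G ->
  4 * #|G| <= \sum_(v : G) #|[set w | edge v w]|.
Proof.
case=> C [L [L3 [c [[cL ce] c_uniq]]]].
pose X (z : C) : int := (enum_rank z : nat).
have XI : injective X by move=> y z [/ord_inj/enum_rank_inj].
have [w wP] := fin_all_exists (fun v => moment_weights XI (L3 v)).
pose r (v : G) : nat := enum_rank v.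
have rI : injective r by move=> y z /ord_inj/enum_rank_inj.
pose s := enum [set e : G * G | edge e.1 e.2 && (r e.1 < r e.2)].
rewrite (edge_count rI) -[4]/(2 * 2) -mulnA mul2n leq_double mul2n leqNgt.
rewrite cardE -/s; apply/negP => lt.
have := @weighted_sum_eq0 _ _ X w s (fun=> 0) (fun v => (wP v).2).
rewrite big1_eq addn0 => /(_ lt).
rewrite (bigD1 c) //= [X in (_ + X)%R]big1 => [|c' nc]; last first.
  (* A nonzero term respects the lists, by its weights, and is proper, by its edge factors, so it
     belongs to [c]. *)
  apply/eqP; apply: contraNT nc; rewrite mulf_eq0 negb_or => /andP[].
  move=> /prodf_neq0 wn0; rewrite prodf_seq_neq0 => /allP en0; apply/eqP/esym/c_uniq; split=> [v|v u].
    by have := wn0 v isT; rewrite expr0 mulr1 (wP v).1.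
  wlog lt_vu : v u / r v < r u => [W vu|vu].
    have: r v != r u by apply: contraTneq vu => /rI ->; rewrite edge_irr.
    rewrite neq_ltn => /orP[/W|/W cuv]; first exact.
    by rewrite eq_sym cuv // edge_sym.
  have := en0 (v, u); rewrite mem_enum inE vu lt_vu => /(_ isT).
  by rewrite subr_eq0 (inj_eq XI).
rewrite addr0; apply/eqP; rewrite mulf_eq0 negb_or; apply/andP; split.
  by apply/prodf_neq0 => v _; rewrite expr0 mulr1 (wP v).1.
rewrite prodf_seq_neq0; apply/allP => -[v u]; rewrite mem_enum inE => /andP[/= vu _].
by rewrite subr_eq0 (inj_eq XI) ce.
Qed.

Lemma unique1 (G : sgraph) : uniquely_list_colorable 1 G.
Proof.
exists G, (fun v => [set v]); split; first by move=> v; rewrite cards1.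
exists [ffun v => v]; split=> [|c [cL _]].
  split=> [v|v w vw]; rewrite !ffunE ?set11 //.
  by apply: contraTneq vw => ->; rewrite edge_irr.
by apply/ffunP => v; rewrite ffunE; have /set1P := cL v.
Qed.

Theorem theorem3 (G : sgraph)
    (nonempty_G : 0 < #|G|)
    (connected_G : connected G)
    (cubic_G : regular 3 G)
    (G_neq_K33 : ~ isomorphic G (complete_bipartite_graph 3 3))
    (G_neq_K4 : ~ isomorphic G (complete_graph 4)) :
  m_number_is G 3.
Proof.
split=> // [/edge_bound_of_unique3|[|[|[|j]]] // _ Mj].
(* The degree sum [3 * #|G|] falls short of [4 * #|G|]. *)
- under eq_bigr do rewrite cubic_G.
  by rewrite sum_nat_const [_ * 3]mulnC leq_pmul2r.
- by case: Mj; exact: unique1.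
have /card_gt0P[x0 _] := nonempty_G.
have [v|x [s [i [Uq cq i_s xi]]]] := chorded_cycle x0; first by rewrite cubic_G.
exfalso; suff [/G_neq_K4|/G_neq_K33] : isomorphic G (complete_graph 4) \/
  isomorphic G (complete_bipartite_graph 3 3) by [].
(* Under property [M] for 2, a chord with nonadjacent successors is impossible, so all chords
   rotate. *)
apply: (K4_or_K33_of_rotating_chords connected_G cubic_G _ Uq cq i_s xi) => q v w Uq' cq' vq wq vw.
apply/negPn/negP => nvw; apply: Mj.
exact: (unique2_of_cycle connected_G Uq' cq' vq wq vw nvw).
Qed.
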